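(* There exists $k_0$ such that for every $k\ge k_0$, the complete $4$-ary tree $T_k$ with $k$ levels admits no empty-ply drawing.
   Context: A complete $d$-ary tree with $k$ levels is a rooted tree in which every vertex at distance less than $k$ from the root has exactly $d$ children and every vertex at distance $k$ from the root is a leaf. A straight-line drawing of a graph places each vertex at a distinct point of the plane and draws each edge as the straight-line segment between its endpoints. For each vertex $v$, the ply-disk $D_v$ is the open disk centered at $v$ with radius equal to half the length of the longest edge incident to $v$. A drawing is empty-ply if every ply-disk $D_v$ contains no vertex other than $v$ in its interior. *)

(* Defs.v *)
From HB Require Import structures.
From mathcomp Require Import all_boot all_order all_algebra.
From mathcomp Require Import all_classical all_reals.

Set Implicit Arguments.
Unset Strict Implicit.
Unset Printing Implicit Defensive.

Import Order.TTheory GRing.Theory Num.Theory.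

Local Open Scope ring_scope.
Local Open Scope classical_set_scope.

Record sgraph := SGraph {
  vertex :> finType;
  adj : rel vertex;
  adj_sym : symmetric adj;
  adj_irr : irreflexive adj
}.

Definition connected_graph (G : sgraph) : Prop :=
  forall x y : G, connect (@adj G) x y.

(* Simple cycles have at least three vertices: [:: x; y] is a [ucycle] as soon
   as x and y are adjacent. *)
Definition acyclic_graph (G : sgraph) : Prop :=
  forall c : seq G, (2 < size c)%N -> ~ ucycle (@adj G) c.

Definition tree (G : sgraph) : Prop := connected_graph G /\ acyclic_graph G.

Definition has_walk (G : sgraph) (x y : G) (n : nat) : bool :=
  [exists p : n.-tuple G, path (@adj G) x p && (last x p == y)].

(* Length of a shortest walk from x to y; equal to #|G| if there is none
   (shortest walks have fewer than #|G| edges). *)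
Definition gdist (G : sgraph) (x y : G) : nat :=
  find (has_walk x y) (iota 0 #|G|).

(* In a tree rooted at r, the neighbours of v other than its parent. *)
Definition children (G : sgraph) (r v : G) : {set G} :=
  [set w : G | adj v w && (gdist r w == (gdist r v).+1)]%SET.

Definition complete_ary_tree (d k : nat) (G : sgraph) (r : G) : Prop :=
  [/\ tree G,
      forall v : G, (gdist r v < k)%N -> #|children r v| = d &
      forall v : G, gdist r v = k -> children r v = finset.set0].

(* The norm of the library on R * R is the maximum norm, not the Euclidean one. *)
Definition edist (R : realType) (a b : R * R) : R :=
  Num.sqrt ((a.1 - b.1) ^+ 2 + (a.2 - b.2) ^+ 2).

(* Edges are the segments between the images of their endpoints, so a drawing
   is determined by the positions of the vertices. *)
Record straight_line_drawing (R : realType) (G : sgraph) := Drawing {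
  pos :> G -> R * R;
  pos_inj : injective pos
}.

Section Ply.
Variables (R : realType) (G : sgraph) (p : straight_line_drawing R G).

Definition ply_radius (v : G) : R :=
  (\big[Num.max/0]_(w | adj v w) edist (p v) (p w)) / 2.

Definition ply_disk (v : G) : set (R * R) :=
  [set q | edist (p v) q < ply_radius v].

Definition empty_ply : Prop :=
  forall v w : G, w != v -> ~ ply_disk v (p w).

End Ply.

(* Main.v *)
(** Let [L v] be the length of the longest edge at [v]. An edge [vw] is at least
    half as long as the longest edges at both of its ends, so [L] changes by a
    factor between 1/2 and 2 from a vertex to its child. Therefore
    [Q = L v * 2 ^+ i], with [i] the depth of [v], never decreases along a
    branch and is multiplied by at most 4 at each step. The edge at depth [j]
    on the way to [v] has length at most [min (L r * 2 ^+ j) (Q / 2 ^+ j)]; by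
    summation, [v] lies at distance O([sqrt (L r * Q)]) from the root [r], so
    far-away vertices have long edges for their depth.

    Squares of half-side [L v / 8] around the vertices are disjoint, so the sum
    of [L v ^+ 2] over the vertices within [rho] of [r] is O([rho ^+ 2]). On the
    annulus of radius [rho = L r * 2 ^+ N] we have
    [4 ^- i = L v ^+ 2 / Q ^+ 2 = O(L r ^+ 2 * L v ^+ 2 / rho ^+ 4)], so the
    vertices of this annulus contribute O([4 ^- N]) to the sum of [4 ^- i] over
    all vertices, which is thus bounded by an absolute constant. But each of the
    [k.+1] levels of the 4-ary tree contributes exactly 1 to it. *)
From mathcomp Require Import all_boot all_order all_algebra.
From mathcomp Require Import all_classical all_reals all_analysis.
From mathcomp Require Import lra ring.
(* Required last: [mathcomp.analysis] also defines an [edist]. *)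
Require Import Defs.

Set Implicit Arguments.
Unset Strict Implicit.
Unset Printing Implicit Defensive.

Import Order.TTheory GRing.Theory Num.Theory.

(** * Graph distance and parents in a tree *)

Section Distance.
Variable G : sgraph.
Implicit Types (x y v w : G) (s : seq G).

Lemma gdist_le_path x s : path (@adj G) x s -> gdist x (last x s) <= size s.
Proof.
(* [gdist] never exceeds its default value [#|G|], so long walks need no search. *)
move=> ps; rewrite /gdist; have [ltsG|leGs] := ltnP (size s) #|G|; last first.
  by apply: leq_trans leGs; rewrite -[leqRHS](size_iota 0) find_size.
rewrite leqNgt; apply/negP => /(before_find 0); rewrite nth_iota // add0n.
by case/existsP; exists (in_tuple s); rewrite ps eqxx.
Qed.

Hypothesis cG : connected_graph G.

Lemma gdist_path x y :
  exists s, [/\ path (@adj G) x s, last x s = y & size s = gdist x y].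
Proof.
(* A repetition-free walk has fewer than [#|G|] edges, so the search defining [gdist] succeeds. *)
have /connectP[s ps ->] := cG x y; have [s' ps' us' _] := shortenP ps.
have hs' : has (has_walk x (last x s')) (iota 0 #|G|).
  apply/hasP; exists (size s'); last first.
    by apply/existsP; exists (in_tuple s'); rewrite ps' eqxx.
  by rewrite mem_iota /= add0n -[_.+1](card_uniqP us') max_card.
have := nth_find 0 hs'; rewrite nth_iota; last first.
  by rewrite -[ltnRHS](size_iota 0) -has_find.
case/existsP => t /andP[pt /eqP lt]; exists t; split=> //.
by rewrite size_tuple add0n.
Qed.

Lemma gdist_adj x v w : adj v w -> gdist x w <= (gdist x v).+1.
Proof.
move=> vw; have [s [ps ls <-]] := gdist_path x v.
rewrite -(size_rcons s w) -[w in gdist _ w](last_rcons x s w).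
by apply: gdist_le_path; rewrite rcons_path ps ls.
Qed.

Lemma gdist_parent x w n :
  gdist x w = n.+1 -> exists2 v, adj v w & gdist x v = n.
Proof.
have [s [ps ls ss]] := gdist_path x w; rewrite -ss.
case/lastP: s ps ls ss => // s y; rewrite rcons_path last_rcons size_rcons.
case/andP => ps lsy yw ss [sn]; rewrite yw in lsy; exists (last x s) => //.
apply/eqP; rewrite eqn_leq -{1}sn gdist_le_path //= -ltnS -sn ss.
exact: gdist_adj.
Qed.

Lemma gdist_refl x : gdist x x = 0.
Proof. by apply/eqP; rewrite -leqn0; exact: (@gdist_le_path x [::]). Qed.

Hypothesis aG : acyclic_graph G.

(** Two distinct parents of [w] would be joined through [x] by a path avoiding [w]; adding [w]
    closes it to a cycle. *)
Lemma parent_unique x v v' w : adj v w -> adj v' w ->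
  gdist x v < gdist x w -> gdist x v' < gdist x w -> v = v'.
Proof.
move=> vw v'w ltvw ltv'w; apply: contrapT => /eqP vNv'.
pose e := [rel y z : G | [&& adj y z, y != w & z != w]].
(* A shortest walk to [u] misses [w]: each of its prefixes is too short to end there. *)
have near u : gdist x u < gdist x w -> connect e x u.
  have [s [ps <- <-]] := gdist_path x u => lts.
  apply/connectP; exists s => //.
  elim/last_ind: s ps lts => // s y IHs; rewrite !rcons_path size_rcons.
  have neq t : path (@adj G) x t -> size t < gdist x w -> last x t != w.
    move=> pt; apply: contraTneq => <-; rewrite -leqNgt.
    exact: gdist_le_path.
  move=> /andP[ps sy] lts; rewrite IHs ?(ltnW lts) //= sy neq ?(ltnW lts) //=.
  by rewrite -(last_rcons x s y) neq ?rcons_path ?ps ?size_rcons.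
have e_sym : symmetric e by move=> y z /=; rewrite adj_sym [(y != w) && _]andbC.
have : connect e v v'.
  by apply: connect_trans (near v' ltv'w); rewrite (sym_connect_sym e_sym) near.
case/connectP => s es lsv'; case: (shortenP es) lsv' => s' es' us' _ lsv'.
have as' : path (@adj G) v s' by apply: sub_path es' => y z /and3P[].
have wNs' : w \notin v :: s'.
  rewrite inE negb_or; apply/andP; split.
    by apply: contraTneq ltvw => <-; rewrite ltnn.
  elim: s' v es' {as' us' vw ltvw vNv' es lsv'} => //= y s' IHs v.
  by case/andP=> /and3P[_ _ yw] es'; rewrite inE negb_or eq_sym yw (IHs y).
apply: (aG (c := w :: v :: s')).
  by case: s' lsv' {es' us' as' wNs'} => //= v'v; rewrite v'v eqxx in vNv'.
rewrite /ucycle cons_uniq wNs' us' /= rcons_path as' andbT -lsv'.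
by rewrite adj_sym vw v'w.
Qed.

End Distance.

(** Double counting of the edges between levels [i] and [i.+1]: [d] below each upper vertex, one
    above each lower vertex. *)
Lemma card_level d k (G : sgraph) (r : G) i : complete_ary_tree d k r ->
  i <= k -> #|[set v | gdist r v == i]%SET| = d ^ i.
Proof.
case=> [[cG aG] card_children _]; elim: i => [|i IHi] ik.
  rewrite expn0; apply/eqP/cards1P; exists r; apply/setP => v; rewrite !inE.
  apply/eqP/eqP => [|->]; last exact: gdist_refl.
  by have [s [_ <- <-]] := gdist_path cG r v; case: s.
rewrite expnSr -(IHi (ltnW ik)) -sum_nat_const.
have -> : \sum_(v in [set v | gdist r v == i]%SET) d =
          \sum_(v in [set v | gdist r v == i]%SET) \sum_(w in children r v) 1.
  by apply: eq_bigr => v; rewrite inE sum1_card => /eqP vi;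
    rewrite card_children ?vi.
rewrite (exchange_big_dep [in [set v | gdist r v == i.+1]%SET]) /=; last first.
  by move=> v w; rewrite !inE => /eqP -> /andP[].
rewrite -sum1_card; apply: eq_bigr => w; rewrite inE => /eqP wi.
have [v0 v0w v0i] := gdist_parent cG wi.
rewrite (big_pred1 v0) // => v; rewrite !inE wi.
apply/andP/eqP => [[/eqP vi /andP[vw _]]|->]; last by rewrite v0i v0w !eqxx.
by apply: (parent_unique cG aG (x := r) vw v0w); rewrite ?vi ?v0i wi.
Qed.

Local Open Scope ring_scope.
Local Open Scope classical_set_scope.

(** * Packing squares in the plane by Lebesgue measure *)

Section SquarePacking.
Variable R : realType.
Implicit Types (c : R * R) (h : R).

Let area := (@lebesgue_measure R \x @lebesgue_measure R)%E.
Let square c h : set (R * R) :=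
  `]c.1 - h, c.1 + h[ `*` `]c.2 - h, c.2 + h[.

Let lebesgue_centered (x h : R) : 0 <= h ->
  lebesgue_measure `]x - h, x + h[ = (2 * h)%:E.
Proof.
move=> h0; rewrite lebesgue_measure_itv /= lte_fin -EFinB.
by case: ltP => ?; congr EFin; lra.
Qed.

Let measurable_square c h : measurable (square c h).
Proof. by apply: measurableX; exact: measurable_itv. Qed.

Let area_square c h : 0 <= h -> area (square c h) = ((2 * h) ^+ 2)%:E.
Proof.
move=> h0; rewrite /area /square product_measure1E; [|exact: measurable_itv..].
have side x := lebesgue_centered x h0.
by apply: etrans (congr2 mule (side _) (side _)) _.
Qed.

Let squareP c h q : square c h q <-> `|q - c| < h.
Proof.
rewrite prod_normE gt_max !ltr_distl /square /= !in_itv /=.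
by split=> [[-> ->]|/andP].
Qed.

(** The open balls of the maximum norm are squares. Those of radius [h i] are disjoint and lie in
    the one of radius [H] around [a], so their areas add up to at most its area. *)
Lemma square_packing (I : finType) (P : pred I) (c : I -> R * R) (h : I -> R)
    (a : R * R) (H : R) :
    0 <= H ->
    (forall i, P i -> 0 <= h i) ->
    (forall i j, P i -> P j -> i != j -> h i + h j <= `|c i - c j|) ->
    (forall i, P i -> `|c i - a| + h i <= H) ->
  \sum_(i | P i) h i ^+ 2 <= H ^+ 2.
Proof.
move=> H0 h0 hd hH.
have -> : \sum_(i | P i) h i ^+ 2 = (\sum_(i | P i) (2 * h i) ^+ 2) / 4.
  by rewrite mulr_suml; apply: eq_bigr => i _; field.
suff : \sum_(i | P i) (2 * h i) ^+ 2 <= (2 * H) ^+ 2 by lra.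
rewrite -lee_fin -(area_square a H0) -sumEFin.
under eq_bigr => i Pi do rewrite -(area_square (c i) (h0 i Pi)).
rewrite -big_enum /= fsbig_seq ?enum_uniq //.
rewrite -measure_fin_bigcup //; last 2 first.
- apply/trivIsetP => i j /=; rewrite !mem_enum => Pi Pj ij.
  rewrite -subset0 => q [/squareP qi /squareP qj].
  have := hd i j Pi Pj ij; apply/negP; rewrite -ltNge.
  rewrite (le_lt_trans _ (ltrD qi qj)) // (distrC q (c i)).
  exact: ler_distD.
- by move=> i _; exact: measurable_square.
- apply: le_measure.
  + rewrite inE; apply: fin_bigcup_measurable => // i _.
    exact: measurable_square.
  + by rewrite inE; exact: measurable_square.
  + move=> q [i]; rewrite /= mem_enum => Pi /squareP qi; apply/squareP.
    apply: lt_le_trans (hH i Pi).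
    by rewrite (le_lt_trans (ler_distD (c i) _ _)) // addrC ltrD2l.
Qed.

End SquarePacking.

Local Close Scope classical_set_scope.

Lemma norm_le_edist (R : realType) (a b : R * R) : `|a - b| <= edist a b.
Proof.
rewrite prod_normE ge_max /edist; apply/andP; split;
  by rewrite -sqrtr_sqr ler_wsqrtr // ?lerDl ?lerDr sqr_ge0.
Qed.

Lemma edist_le_norm (R : realType) (a b : R * R) :
  edist a b <= 2 * `|a - b|.
Proof.
have ab0 : 0 <= 2 * `|a - b| by rewrite mulr_ge0.
rewrite /edist -[leRHS](ger0_norm ab0) -sqrtr_sqr ler_wsqrtr //.
have sqr_le x : `|x| <= `|a - b| -> x ^+ 2 <= `|a - b| ^+ 2.
  by move=> le_x; rewrite -real_normK ?num_real // ler_sqr ?nnegrE.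
have := sqr_ge0 `|a - b|.
have := sqr_le (a - b).1; have := sqr_le (a - b).2.
rewrite prod_normE !le_max !lexx orbT => /(_ isT) le2 /(_ isT) le1 n0.
by rewrite exprMn; move: le1 le2 n0 => /=; lra.
Qed.

Lemma edistC (R : realType) (a b : R * R) : edist a b = edist b a.
Proof. by rewrite /edist -(sqrrN (a.1 - b.1)) -(sqrrN (a.2 - b.2)) !opprB. Qed.

(** * Edge lengths in an empty-ply drawing *)

Section EmptyPly.
Variables (R : realType) (G : sgraph) (p : straight_line_drawing R G).
Hypothesis ep : empty_ply p.
Implicit Types v w r : G.

Definition longest_edge v : R :=
  \big[Num.max/0]_(w | adj v w) edist (p v) (p w).
Local Notation L := longest_edge.

Lemma longest_edge_ge0 v : 0 <= L v.
Proof. exact: bigmax_ge_id. Qed.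

Lemma edist_le_longest v w : adj v w -> edist (p v) (p w) <= L v.
Proof. exact: le_bigmax_cond. Qed.

Lemma longest_le_edist v w : w != v -> L v <= 2 * edist (p v) (p w).
Proof. by move=> /ep /negP; rewrite -leNgt /ply_radius -/(L v); lra. Qed.

Lemma longest_le_norm v w : w != v -> L v <= 4 * `|p v - p w|.
Proof. by move=> /longest_le_edist; have := edist_le_norm (p v) (p w); lra. Qed.

Lemma adj_neq v w : adj v w -> w != v.
Proof. by apply: contraTneq => ->; rewrite adj_irr. Qed.

Lemma longest_adj v w : adj v w -> L v <= 2 * L w.
Proof.
move=> vw; apply: le_trans (longest_le_edist (adj_neq vw)) _.
by rewrite ler_pM2l // edistC edist_le_longest // adj_sym.
Qed.

Lemma norm_le_longest v w : adj v w -> `|p v - p w| <= L v.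
Proof. by move=> /edist_le_longest; apply: le_trans; exact: norm_le_edist. Qed.

Lemma longest_edge_gt0 v w : adj v w -> 0 < L v.
Proof.
move=> vw; apply: lt_le_trans (norm_le_longest vw).
rewrite normr_gt0 subr_eq0; apply: contraTneq (adj_neq vw) => /pos_inj ->.
by rewrite eqxx.
Qed.

(** Distinct centres are at least [L v / 4] and [L w / 4] apart, hence at least the average
    [L v / 8 + L w / 8]. For [v != r], [L v / 8] is at most half the distance to [p r], so half-side
    [3 / 2 * rho] suffices; [144 = 64 * 9 / 4]. *)
Lemma longest_packing r (rho : R) : L r <= rho ->
  \sum_(v | `|p v - p r| < rho) L v ^+ 2 <= 144 * rho ^+ 2.
Proof.
move=> Lr; have rho0 : 0 <= rho by apply: le_trans Lr; exact: longest_edge_ge0.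
suff : \sum_(v | `|p v - p r| < rho) (L v / 8) ^+ 2 <= (3 / 2 * rho) ^+ 2.
  under eq_bigr do rewrite expr_div_n.
  by rewrite -mulr_suml ler_pdivrMr // => /le_trans; apply; nra.
apply: (@square_packing R G _ (fun v => p v) _ (p r)).
- by rewrite mulr_ge0.
- by move=> v _; rewrite divr_ge0 // longest_edge_ge0.
- move=> v w _ _ vw.
  have := longest_le_norm vw; rewrite distrC.
  by have := @longest_le_norm v w; rewrite eq_sym => /(_ vw); lra.
- move=> v vrho; have [->|rv] := eqVneq v r; first by rewrite subrr normr0; lra.
  by have := @longest_le_norm v r; rewrite eq_sym => /(_ rv); lra.
Qed.

(* The term [2 * L v] makes the distance estimate inductive: it pays for all
   further steps along which [L] is halved each time. *)
Lemma walk_estimate r s : 0 < L r -> path (@adj G) r s ->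
  let v := last r s in let i := size s in
  [/\ L r <= L v * 2 ^+ i, L v * 2 ^+ i <= L r * 4 ^+ i &
      `|p v - p r| + 2 * L v <= 3 * Num.sqrt (L r * (L v * 2 ^+ i))].
Proof.
move=> Lr0; elim/last_ind: s => [|s w IHs] /=.
  by rewrite !expr0 subrr normr0 !mulr1 -expr2 sqrtr_sqr gtr0_norm //;
    split; lra.
rewrite rcons_path last_rcons size_rcons => /andP[/IHs [] lo hi est].
set v := last r s in lo hi est *; set i := size s in lo hi est * => vw.
have wv : adj w v by rewrite adj_sym.
have vLw := longest_adj vw; have wLv := longest_adj wv.
have Lv0 := longest_edge_ge0 v.
have i0 : 0 < 2 ^+ i :> R by rewrite exprn_gt0.
rewrite !exprS; split.
- by apply: le_trans lo _; rewrite mulrA ler_wpM2r ?(ltW i0) //; lra.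
- have : L w * (2 * 2 ^+ i) <= 4 * (L v * 2 ^+ i).
    by rewrite !mulrA ler_wpM2r ?(ltW i0) //; lra.
  by lra.
have tri : `|p w - p r| <= `|p v - p r| + L v.
  by apply: le_trans (ler_distD (p v) _ _) _;
    rewrite addrC lerD2l distrC norm_le_longest.
set Q := L v * 2 ^+ i in lo hi est *; set Q' := L w * (2 * 2 ^+ i).
have Q0 : 0 < Q := lt_le_trans Lr0 lo.
have QQ' : Q <= Q' by rewrite /Q /Q' mulrA ler_wpM2r ?(ltW i0) //; lra.
have Q'Q : Q' <= 4 * Q by rewrite /Q /Q' !mulrA ler_wpM2r ?(ltW i0) //; lra.
set x := Num.sqrt (L r * Q) in est *; set y := Num.sqrt (L r * Q').
have x0 : 0 <= x := sqrtr_ge0 _; have y0 : 0 <= y := sqrtr_ge0 _.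
have x2 : x ^+ 2 = L r * Q by rewrite sqr_sqrtr // mulr_ge0 // ltW.
have y2 : y ^+ 2 = L r * Q'.
  by rewrite sqr_sqrtr // mulr_ge0 ?(ltW Lr0) // (le_trans _ QQ') // ltW.
have xy : x <= y by rewrite ler_wsqrtr // ler_pM2l.
have yx : y <= 2 * x.
  by rewrite -ler_sqr ?nnegrE ?mulr_ge0 // exprMn x2 y2 [leRHS]mulrCA
    ler_pM2l //; lra.
(* The goal reduces to [2 * L w - L v <= 3 * (y - x)]. Multiplied by [t], the left side becomes
   [y ^+ 2 - x ^+ 2], and [y + x <= 3 * x <= 3 * t]. *)
pose t := L r * 2 ^+ i; have t0 : 0 < t by rewrite mulr_gt0.
have xt : x <= t.
  rewrite -ler_sqr ?nnegrE ?(ltW t0) // x2 exprMn expr2 -mulrA ler_pM2l //.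
  by rewrite -exprM mulnC exprM -natrX.
have diff : t * (2 * L w - L v) = (y - x) * (y + x).
  by rewrite -subr_sqr x2 y2 /t /Q /Q'; ring.
suff : 2 * L w - L v <= 3 * (y - x) by lra.
by rewrite -(ler_pM2l t0) diff; nra.
Qed.

End EmptyPly.

(** * Total weight of the levels, from below *)

Lemma expr4_sqr (R : pzRingType) n : 4 ^+ n = (2 ^+ n) ^+ 2 :> R.
Proof. by rewrite -exprM mulnC exprM expr2 -natrM. Qed.

Definition level_weight (R : realType) (G : sgraph) (r v : G) : R :=
  (4 ^+ gdist r v)^-1.

Lemma level_weight_ge0 (R : realType) (G : sgraph) (r v : G) :
  0 <= level_weight R r v.
Proof. by rewrite invr_ge0 exprn_ge0. Qed.

Lemma sum_level_weight_ge (R : realType) k (G : sgraph) (r : G) :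
  complete_ary_tree 4 k r -> k.+1%:R <= \sum_v level_weight R r v.
Proof.
move=> Gk.
suff lower n : (n <= k.+1)%N ->
    n%:R <= \sum_(v | (gdist r v < n)%N) level_weight R r v.
  apply: le_trans (lower _ (leqnn _)) _.
  rewrite [leRHS](bigID (fun v => (gdist r v < k.+1)%N)) /=.
  by rewrite lerDl sumr_ge0 // => v _; exact: level_weight_ge0.
elim: n => [|n IHn] nk.
  by rewrite sumr_ge0 // => v _; exact: level_weight_ge0.
rewrite (bigID (fun v => (gdist r v < n)%N)) /= -natr1; apply: lerD.
  rewrite (eq_bigl (fun v => (gdist r v < n)%N)) ?IHn 1?ltnW // => v.
  by case: (ltnP _ n) => vn; rewrite ?andbF // andbT ltnW.
rewrite (eq_bigl [in [set v | gdist r v == n]%SET]) => [|v]; last first.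
  by rewrite inE -leqNgt ltnS -eqn_leq.
rewrite (eq_bigr (fun=> (4 ^+ n)^-1)) => [|v]; last first.
  by rewrite inE /level_weight => /eqP ->.
by rewrite sumr_const (card_level Gk) // -[leRHS]mulr_natr natrX mulVf.
Qed.

(** * Total weight of the vertices, from above *)

Section EmptyPlyWeight.
Variables (R : realType) (G : sgraph) (p : straight_line_drawing R G) (r : G).
Hypotheses (cG : connected_graph G) (ep : empty_ply p).
Hypothesis Lr0 : 0 < longest_edge p r.
Local Notation L := (longest_edge p).
Local Notation W := (level_weight R r).

Lemma gdist_estimate v :
  [/\ L r <= L v * 2 ^+ gdist r v &
      `|p v - p r| <= 3 * Num.sqrt (L r * (L v * 2 ^+ gdist r v))].
Proof.
have [s [ps sv <-]] := gdist_path cG r v.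
have [lo _ est] := walk_estimate ep Lr0 ps; rewrite sv in lo est.
by split=> //; apply: le_trans est; rewrite lerDl mulr_ge0 // longest_edge_ge0.
Qed.

Lemma near_weight v : W v * L r ^+ 2 <= L v ^+ 2.
Proof.
have [lo _] := gdist_estimate v.
rewrite mulrC ler_pdivrMr ?exprn_gt0 // expr4_sqr.
by rewrite -exprMn ler_sqr // nnegrE ?(ltW Lr0) // (le_trans _ lo) // ltW.
Qed.

(** With [Q = L v * 2 ^+ gdist r v], the distance estimate gives [rho ^+ 2 <= 9 * (L r * Q)];
    squaring it brings out [4 ^+ gdist r v], which the weight cancels. *)
Lemma far_weight v (rho : R) : 0 <= rho -> rho <= `|p v - p r| ->
  W v * rho ^+ 4 <= 81 * L r ^+ 2 * L v ^+ 2.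
Proof.
move=> rho0 rhov; have [lo est] := gdist_estimate v.
set x := L r * _ in est.
have x0 : 0 <= x by rewrite mulr_ge0 ?(le_trans (ltW Lr0) lo) ?ltW.
rewrite mulrC ler_pdivrMr ?exprn_gt0 // expr4_sqr.
have -> : 81 * L r ^+ 2 * L v ^+ 2 * (2 ^+ gdist r v) ^+ 2 = (9 * x) ^+ 2.
  by rewrite /x; ring.
move: x est x0 => x est x0.
rewrite (exprM rho 2 2) ler_sqr ?nnegrE ?sqr_ge0 ?mulr_ge0 //.
have : rho ^+ 2 <= (3 * Num.sqrt x) ^+ 2.
  by rewrite ler_sqr ?nnegrE ?mulr_ge0 // (le_trans rhov).
by rewrite exprMn sqr_sqrtr //; lra.
Qed.

(* The ball of radius [L r] contributes at most 144, and the [N]-th annulus at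
   most [81 * 144 * 2 ^ 2 / 4 ^+ N = 144 * 324 / 4 ^+ N]. *)
Lemma sum_weight_ball N :
  \sum_(v | `|p v - p r| < L r * 2 ^+ N) W v <= 144 * (433 - 432 / 4 ^+ N).
Proof.
elim: N => [|N IHN].
  rewrite !expr0 mulr1 -(ler_pM2r (exprn_gt0 2 Lr0)) mulr_suml.
  apply: (@le_trans _ _ (144 * L r ^+ 2)); last by nra.
  apply: le_trans (longest_packing ep (lexx _)).
  by apply: ler_sum => v _; exact: near_weight.
pose rho := L r * 2 ^+ N.
have two0 : 0 < 2 ^+ N :> R by rewrite exprn_gt0.
have rho0 : 0 < rho by rewrite mulr_gt0.
have rhoS : L r * 2 ^+ N.+1 = 2 * rho by rewrite exprS mulrCA.
have Lrho : L r <= 2 * rho.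
  have : L r <= rho by rewrite ler_peMr ?(ltW Lr0) // exprn_ege1 // ler1n.
  by move: rho rho0 {rhoS} => x x0; lra.
rewrite rhoS (bigID (fun v => `|p v - p r| < rho)) /=.
have inner : \sum_(v | (`|p v - p r| < 2 * rho) && (`|p v - p r| < rho)) W v
    <= 144 * (433 - 432 / 4 ^+ N).
  rewrite (eq_bigl (fun v => `|p v - p r| < rho)) // => v.
  by case: (ltP _ rho) => vrho; rewrite ?andbF // andbT; lra.
have outer : \sum_(v | (`|p v - p r| < 2 * rho) && ~~ (`|p v - p r| < rho)) W v
    <= 144 * (324 / 4 ^+ N).
  rewrite -(ler_pM2r (exprn_gt0 4 rho0)) mulr_suml.
  apply: (@le_trans _ _ (81 * L r ^+ 2 * (144 * (2 * rho) ^+ 2))); last first.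
    rewrite expr4_sqr le_eqVlt; apply/orP; left; apply/eqP; rewrite /rho; field.
    by rewrite gt_eqF.
  have c0 : 0 <= 81 * L r ^+ 2 by rewrite mulr_ge0 // sqr_ge0.
  (* The annulus is enlarged to the whole ball of radius [2 * rho], where the packing bound
     applies. *)
  apply: le_trans (ler_wpM2l c0 (longest_packing ep Lrho)).
  rewrite mulr_sumr [leRHS](bigID (fun v => `|p v - p r| < rho)) /=.
  rewrite -[leLHS]add0r lerD ?sumr_ge0 //.
    by move=> v _; rewrite mulr_ge0 ?sqr_ge0.
  by apply: ler_sum => v /andP[_]; rewrite -leNgt => /far_weight ->;
    rewrite ?ltW.
(* The geometric series telescopes because [324 = 432 * 3 / 4]. *)
have -> : 432 / 4 ^+ N.+1 = 432 / 4 ^+ N - 324 / 4 ^+ N :> R.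
  by rewrite exprS; field; rewrite expf_neq0 // pnatr_eq0.
lra.
Qed.

Lemma sum_weight_le : \sum_v W v <= 144 * 433.
Proof.
(* [M] bounds every distance to [p r], so the ball of radius [L r * 2 ^+ N] contains all
   vertices. *)
pose M := \sum_v `|p v - p r|.
pose N := Num.bound (M / L r).
have MN : M < L r * 2 ^+ N.
  by rewrite mulrC -ltr_pdivrMr //; exact: upper_nthrootP.
have := sum_weight_ball N; rewrite (eq_bigl xpredT) => [|v].
  by move=> /le_trans; apply; rewrite ler_pM2l // gerBl divr_ge0 // exprn_ge0.
apply: le_lt_trans MN; rewrite /M (bigD1 v) //= lerDl.
by rewrite sumr_ge0.
Qed.

End EmptyPlyWeight.

Theorem theorem7 (R : realType) :
  exists k0 : nat, forall k : nat, (k0 <= k)%N ->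
    forall (T : sgraph) (r : T), complete_ary_tree 4 k r ->
      ~ exists p : straight_line_drawing R T, empty_ply p.
Proof.
(* The successor makes [k] visibly positive, so the root has a child and [longest_edge p r] is
   positive. *)
exists (Num.bound (144 * 433 : R)).+1 => k k0 T r Tk [p ep].
have [[cT _] card_children _] := Tk.
have : (0 < #|children r r|)%N.
  by rewrite card_children // gdist_refl (leq_trans _ k0).
case/card_gt0P => w; rewrite inE => /andP[rw _].
have := sum_weight_le cT ep (longest_edge_gt0 p rw).
have := sum_level_weight_ge R Tk => /le_trans /[apply].
apply/negP; rewrite -ltNge.
apply: lt_le_trans (archi_boundP _) _ => //.
by rewrite ler_nat (leq_trans (leqnSn _)) // (leq_trans k0).
Qed.
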